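(* Let $0=t_0<t_1<\dots<t_N=T$ with $T>0$ finite, $\delta_n=t_{n+1}-t_n$, and $x_0\in\mathbb{R}^d$. Let $x$ be the solution of the original system $\frac{d}{dt}x(t)=f(x,\gamma(t))$, $x(0)=x_0$, with external input $\gamma$. Let $\tilde\gamma$ be the piecewise parameterized input with local parameters $\Gamma_0,\dots,\Gamma_{N-1}\in\mathbb{R}^{n_b}$, and let $\tilde x$ be the solution of the modified system $\frac{d}{dt}\tilde x(t)=f(\tilde x,\tilde\gamma(t))$, $\tilde x(0)=x_0$. Let $\tilde\phi$ be the one-step increment function, so that $\tilde x(t_{n+1})=\tilde x(t_n)+\tilde\phi(\tilde x(t_n),\Gamma_n,\delta_n)$ for $n=0,\dots,N-1$. Let $\mathbf{N}(\cdot;\Theta^* )$ be the trained network and $\mathcal{D}$ the convex hull of the training data (all defined in the context). Let $\hat x(t_n)$ be the solution of the trained network model $$\hat x(t_0)=x_0,\qquad \hat x(t_{n+1})=\hat x(t_n)+\mathbf{N}(\hat x(t_n),\Gamma_n,\delta_n;\Theta^* ),\quad n=0,\dots,N-1.$$ Assume: 1. $f(x,\gamma)$ is Lipschitz continuous with respect to both $x$ and $\gamma$, with Lipschitz constants $L_1$ and $L_2$, respectively; 2. $\|\gamma(t)-\tilde\gamma(t)\|_{L^\infty([0,T])}\le\eta$; 3. the exact one-step evolution operator $\tilde x(t_n)\mapsto\tilde x(t_{n+1})=\tilde x(t_n)+\tilde\phi(\tilde x(t_n),\Gamma_n,\delta_n)$ is Lipschitz continuous with respect to the state variable, with Lipschitz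 constant $L_\phi$; 4. the network training is sufficiently accurate, such that $\|\mathbf{N}(\cdot;\Theta^* )-\tilde\phi(\cdot)\|_{L^\infty(\mathcal{D})}<\mathcal{E}$, where $\mathcal{E}\ge 0$ is a sufficiently small real number. Then $$\|\hat x(t_n)-x(t_n)\|\le L_2\,\eta\,t_n\,e^{L_1t_n}+\frac{1-L_\phi^n}{1-L_\phi}\,\mathcal{E},\qquad n=0,\dots,N.$$
   Context: Here $f:\mathbb{R}^d\times\mathbb{R}\to\mathbb{R}^d$, the input $\gamma$ is a scalar function of time, and $\|\cdot\|$ is a norm on $\mathbb{R}^d$. Parameterized input: let $b_1,\dots,b_{n_b}$ be prescribed analytical basis functions. For $\Gamma=(\Gamma^1,\dots,\Gamma^{n_b})\in\mathbb{R}^{n_b}$ put $p_\Gamma(\tau)=\sum_{j=1}^{n_b}\Gamma^j b_j(\tau)$. The piecewise parameterized input is $\tilde\gamma(t)=\sum_{n=0}^{N-1}p_{\Gamma_n}(t-t_n)\,\mathbb{I}_{[t_n,t_{n+1}]}(t)$, where $\mathbb{I}_A$ is the indicator function of the set $A$. On each interval, $p_{\Gamma_n}(\tau)$ approximates $\gamma(t_n+\tau)$ for $\tau\in[0,\delta_n]$. One-step increment function: for a state $z\in\mathbb{R}^d$, local parameters $\Gamma\in\mathbb{R}^{n_b}$ and step $\delta$, let $y$ solve $y'(\tau)=f(y(\tau),p_\Gamma(\tau))$, $y(0)=z$, on $[0,\delta]$. Then $\tilde\phi(z,\Gamma,\delta)=\int_0^\delta f(y(\tau),p_\Gamma(\tau))\,d\tau=y(\delta)-z$.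 Training data and network: each training datum consists of a state $x^{(j)}_k\in\mathbb{R}^d$, local input parameters $\Gamma^{(j)}_k\in\mathbb{R}^{n_b}$, a time step $\delta^{(j)}_k$, and the state $x^{(j)}_{k+1}$ reached after that step, $j=1,\dots,J$. The network takes the vectors $(x^{(j)}_k,\Gamma^{(j)}_k,\delta^{(j)}_k)\in\mathbb{R}^{d+n_b+1}$ as inputs, and $\mathcal{D}\subset\mathbb{R}^{d+n_b+1}$ is their convex hull. $\mathbf{N}(\cdot;\Theta^* ):\mathbb{R}^{d+n_b+1}\to\mathbb{R}^d$ is the operator of a feed-forward neural network with trained parameters $\Theta^*$.
   Formalization: Added: the points (x̂(t_n),Γ_n,δ_n), n<N, at which the network is evaluated lie in D (without this the claim fails, as assumption 4 says nothing off D); the L^∞(D) norm is read as a true supremum over D; L_φ≠1, so that the quotient is defined. *)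

(* Defs.v *)
From HB Require Import structures.
From mathcomp Require Import all_boot all_order all_algebra.
From mathcomp Require Import all_classical all_reals all_analysis.
Set Implicit Arguments.
Unset Strict Implicit.
Unset Printing Implicit Defensive.
Import Order.TTheory GRing.Theory Num.Theory.
Import numFieldNormedType.Exports.
Local Open Scope classical_set_scope.
Local Open Scope ring_scope.

(* R^d is 'rV[R]_d. An arbitrary norm is carried as a function satisfying
   [is_norm]; the canonical norm `|v| of 'rV[R]_d (maximum of the coordinates)
   only enters through the topology (derivatives, absolute continuity), which
   does not depend on the choice of the norm in finite dimension. *)
Definition is_norm (R : realType) (V : lmodType R) (nrm : V -> R) : Prop :=
  [/\ forall u v, nrm (u + v) <= nrm u + nrm v,
      forall (a : R) v, nrm (a *: v) = `|a| * nrm v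
    & forall v, nrm v = 0 -> v = 0].

(* The sign condition only matters when the source is a trivial space. *)
Definition lipschitz_with (R : realType) (U V : zmodType)
    (nU : U -> R) (nV : V -> R) (L : R) (g : U -> V) : Prop :=
  0 <= L /\ forall u v, nV (g u - g v) <= L * nU (u - v).

Definition real_analytic_at (R : realType) (g : R -> R) (a : R) : Prop :=
  exists (c : nat -> R) (r : R), 0 < r /\
    forall s, `|s - a| < r ->
      series (fun k : nat => c k * (s - a) ^+ k) @ \oo --> g s.

Definition abs_continuous_on (R : realType) (V : normedModType R) (a b : R)
    (x : R -> V) : Prop :=
  forall e : R, 0 < e -> exists2 d : R, 0 < d &
    forall (m : nat) (l r : 'I_m -> R),
      (forall i, [/\ a <= l i, l i <= r i & r i <= b]) ->
      (forall i j, i != j -> `]l i, r i[ `&` `]l j, r j[ = set0) ->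
      \sum_i (r i - l i) < d -> \sum_i `|x (r i) - x (l i)| < e.

(* Solution on [0, T] of x' = f (x, u (t)), x (0) = x0, in the sense of
   Caratheodory: x is absolutely continuous and the equation holds for almost
   every t. The piecewise input jumps at the nodes t_n, so a solution driven by
   it is in general not differentiable there. For a continuous input and a
   continuous f these are the classical solutions. *)
Definition ode_solution (R : realType) (d : nat)
    (f : 'rV[R]_d -> R -> 'rV[R]_d) (u : R -> R) (x0 : 'rV[R]_d) (T : R)
    (x : R -> 'rV[R]_d) : Prop :=
  [/\ x 0 = x0,
      abs_continuous_on 0 T x
    & \forall t \ae (@lebesgue_measure R), 0 <= t <= T ->
        is_derive (t : R) (1 : R) x (f (x t) (u t))].

(* p_Gamma(tau) *)
Definition local_input (R : realType) (nb : nat) (b : 'I_nb -> R -> R)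
    (G : 'rV[R]_nb) (tau : R) : R :=
  \sum_(j < nb) G 0 j * b j tau.

(* The intervals are closed, so at an interior node both adjacent terms
   contribute. *)
Definition piecewise_input (R : realType) (nb : nat) (b : 'I_nb -> R -> R)
    (N : nat) (t : nat -> R) (G : nat -> 'rV[R]_nb) (s : R) : R :=
  \sum_(n < N) local_input b (G n) (s - t n) * \1_(`[t n, t n.+1]) s.

(* y(delta) - z, where y is the solution of y' = f (y, p_Gamma), y (0) = z on
   [0, delta]. When f is Lipschitz and the basis functions are continuous on
   [0, +oo[, this solution exists and is unique on [0, delta], so [xget] does
   select it; the value for delta < 0 is meaningless. *)
Definition one_step_increment (R : realType) (d nb : nat)
    (f : 'rV[R]_d -> R -> 'rV[R]_d) (b : 'I_nb -> R -> R)
    (z : 'rV[R]_d) (G : 'rV[R]_nb) (delta : R) : 'rV[R]_d :=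
  let y := xget (cst z) [set y | ode_solution f (local_input b G) z delta y] in
  y delta - z.

Definition pack_input (R : realType) (d nb : nat)
    (z : 'rV[R]_d) (G : 'rV[R]_nb) (delta : R) : 'rV[R]_(d + nb + 1) :=
  row_mx (row_mx z G) (const_mx delta).

(* The increment as a function on R^(d + nb + 1), the domain of the network. *)
Definition increment_operator (R : realType) (d nb : nat)
    (f : 'rV[R]_d -> R -> 'rV[R]_d) (b : 'I_nb -> R -> R)
    (p : 'rV[R]_(d + nb + 1)) : 'rV[R]_d :=
  one_step_increment f b
    (lsubmx (lsubmx p)) (rsubmx (lsubmx p)) (rsubmx p 0 0).

Record training_datum (R : realType) (d nb : nat) := TrainingDatum {
  td_state : 'rV[R]_d;
  td_param : 'rV[R]_nb;
  td_step : R;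
  td_next : 'rV[R]_d }.

Definition convex_hull (R : realType) (V : lmodType R) (A : set V) : set V :=
  smallest (@convex_set R V) A.

Definition training_domain (R : realType) (d nb J : nat)
    (data : 'I_J -> training_datum R d nb) : set 'rV[R]_(d + nb + 1) :=
  convex_hull
    [set pack_input (td_state (data j)) (td_param (data j)) (td_step (data j))
       | j in [set: 'I_J]].

(* Parameters (weights and biases) of a fully connected feed-forward network
   from R^m to R^n, with any number of hidden layers of any widths. *)
Inductive ffn_params (R : Type) : nat -> nat -> Type :=
| OutputLayer m n of 'M[R]_(m, n) & 'rV[R]_n : ffn_params R m n
| HiddenLayer m k n of 'M[R]_(m, k) & 'rV[R]_k & ffn_params R k n :
    ffn_params R m n.

(* sigma i is the activation of the i-th hidden layer, applied to each
   coordinate. *)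
Fixpoint ffn_eval (R : realType) (sigma : nat -> R -> R) (m n : nat)
    (Theta : ffn_params R m n) {struct Theta} : 'rV[R]_m -> 'rV[R]_n :=
  match Theta in ffn_params _ m n return 'rV[R]_m -> 'rV[R]_n with
  | OutputLayer _ _ W c => fun p => p *m W + c
  | HiddenLayer _ _ _ W c rest => fun p =>
      ffn_eval (fun i => sigma i.+1) rest (map_mx (sigma 0%N) (p *m W + c))
  end.

Definition Linfty_norm_itv (R : realType) (a b : R) (g : R -> R) : \bar R :=
  ('N[mrestr (@lebesgue_measure R) (measurable_itv `[a, b])]_+oo
     [EFin \o g])%E.

(* Supremum over D of the norm of g. An essential supremum with respect to
   Lebesgue measure would not control g when D is contained in a hyperplane,
   which happens as soon as all the time steps of the data are equal. *)
Definition Linfty_norm_on (R : realType) (U V : Type) (nrm : V -> R)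
    (D : set U) (g : U -> V) : \bar R :=
  ereal_sup [set (nrm (g p))%:E | p in D].

(* Main.v *)
(** The difference of two Caratheodory solutions is compared by a Gronwall
    inequality for absolutely continuous functions, obtained without integration
    by a gauge argument: a point where the differential inequality holds controls
    the increment on all short intervals around it, the remaining points lie in
    an open set of small measure on which absolute continuity controls the
    increments, and a compactness argument glues the short intervals together.
    The same inequality with [eta = 0] gives uniqueness, so that the restriction of
    xtilde to [t_n, t_(n+1)], translated to the origin, is the solution selected in
    the one-step increment. The network error then obeys
    [e_(n+1) <= E + Lphi * e_n], and is added to the input error
    [nrm (x - xtilde)]. *)
Require Import Defs.
From HB Require Import structures.
From mathcomp Require Import all_boot all_order all_algebra.
From mathcomp Require Import all_classical all_reals all_analysis.
From mathcomp Require Import measurable_realfun ess_sup_inf ring lra.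
Set Implicit Arguments.
Unset Strict Implicit.
Import Order.TTheory GRing.Theory Num.Theory.
Import numFieldNormedType.Exports.
Local Open Scope classical_set_scope.
Local Open Scope ring_scope.

(** * Growth of absolutely continuous functions *)

(** Let [c] be the supremum of the points reachable from [a]. The local hypothesis at [c] joins a
    reachable point just before [c] to every nearby point from [c] on, so [c] cannot stop short of
    [b], and [b] itself is reached. *)
Lemma interval_gluing (R : realType) (P : R -> R -> Prop) (a b : R) :
  a <= b ->
  (forall u v w, a <= u -> u <= v -> v <= w -> w <= b ->
    P u v -> P v w -> P u w) ->
  (forall s, a <= s -> s <= b -> exists2 r, 0 < r &
    forall u v, a <= u -> u <= s -> s <= v -> v <= b ->
      s - u < r -> v - s < r -> P u v) ->
  P a b.
Proof.
move=> ab glue loc.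
pose S := [set s | a <= s <= b /\ P a s].
have Sa : S a.
  split; first by rewrite lexx ab.
  have [r r0 /(_ a a)] := loc a (lexx a) ab.
  by rewrite subrr; apply.
have ubS : ubound S b by move=> s [/andP[]].
have hS : has_sup S by split; [exists a | exists b].
pose c := sup S.
have ac : a <= c by apply: ub_le_sup => //; exists b.
have cb : c <= b by apply: ge_sup => //; exists a.
have [r r0 Pr] := loc c ac cb.
have [s [/andP[as_ sb] Pas] rs] := sup_adherent r0 hS.
have sc : s <= c by apply: ub_le_sup => //; [exists b|split => //; rewrite as_ sb].
rewrite -/c in rs.
have step v : c <= v -> v <= b -> v - c < r -> P a v.
  move=> cv vb vr; apply: (glue a s v) => //; first lra.
  by apply: Pr => //; lra.
have [cr|rc] := ltP (c + r / 2) b; last by apply: step => //; lra.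
suff : c + r / 2 <= c by lra.
apply: ub_le_sup; first by exists b.
by split; [apply/andP; split; lra | apply: step; lra].
Qed.

(** The hypothesis bounds increments over intervals straddling [s] instead of a derivative at [s],
    so that it applies to the norm of a curve, which may fail to be differentiable. *)
Lemma abs_continuous_growth (R : realType) (h : R -> R) (a b M : R) :
  0 <= M -> a <= b -> abs_continuous_on a b (h : R -> R^o) ->
  (\forall s \ae (@lebesgue_measure R), a <= s <= b ->
    forall e, 0 < e -> exists2 r, 0 < r &
    forall u v, a <= u -> u <= s -> s <= v -> v <= b ->
      s - u < r -> v - s < r -> h v - h u <= (M + e) * (v - u)) ->
  h b - h a <= M * (b - a).
Proof.
move=> M0 ab ach [Z [mZ Z0 subZ]].
apply/ler_addgt0Pr => e e0.
(* Half of [e] pays for the excess slope [e'] over the whole interval, the other half for the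
   variation near [Z]. The added 1 covers the case [a = b]. *)
pose e' := e / 2 / (b - a + 1).
have e'0 : 0 < e' by rewrite !divr_gt0//; lra.
have e'E : e' * (b - a) <= e / 2.
  rewrite /e' -mulrA ler_piMr//; first lra.
  by rewrite mulrC ler_pdivrMr; lra.
have [d d0 acd] := ach (e / 2) ltac:(lra).
have d20 : 0 < d / 2 by lra.
have [|U [oU ZU mUZ]] := lebesgue_regularity_outer mZ _ d20.
  by rewrite [X in (X < _)%E]Z0 ltry.
have mU : measurable U by exact: open_measurable.
have muU : (lebesgue_measure U < d%:E)%E.
  rewrite -(setDUK ZU) measureU//; last 2 first.
  - exact: measurableD.
  - by apply/seteqP; split => // y [? []].
  rewrite [X in (X + _)%E]Z0 add0e; apply: (lt_trans mUZ).
  by rewrite lte_fin; lra.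
(* [s] lists disjoint subintervals of U: their total length is below [d], so
   absolute continuity bounds the variation of [h] over them by [e / 2]. *)
pose P u v := exists s : seq (R * R),
  [/\ all (fun p => [&& u <= p.1, p.1 <= p.2 & p.2 <= v]) s,
      pairwise (fun p q => p.2 <= q.1) s,
      ((\sum_(p <- s) (p.2 - p.1))%:E <=
         lebesgue_measure (U `&` `]u, v]%classic))%E &
      h v - h u <= (M + e') * (v - u) + \sum_(p <- s) `|h p.2 - h p.1|].
(* The intervals are half-open so that adjacent ones are disjoint and the measures of their traces
   on [U] add up under gluing. *)
have mUI u v : measurable (U `&` `]u, v]%classic).
  by apply: measurableI => //; exact: measurable_itv.
suff [s [sab sord smu hs]] : P a b.
  suff : \sum_(p <- s) `|h p.2 - h p.1| < e / 2.
    rewrite mulrDl in hs; lra.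
  rewrite (big_nth (0, 0)) big_mkord.
  apply: (acd _ (fun i => (nth (0, 0) s i).1) (fun i => (nth (0, 0) s i).2)).
  - by move=> i; apply/and3P; move/(all_nthP (0, 0)): sab; apply.
  - have dis (i j : 'I_(size s)) : (i < j)%N ->
        `](nth (0, 0) s i).1, (nth (0, 0) s i).2[%classic `&`
        `](nth (0, 0) s j).1, (nth (0, 0) s j).2[%classic = set0.
      move=> ij; apply/seteqP; split => // y [] /=.
      have := pairwiseP (0, 0) sord i j (ltn_ord i) (ltn_ord j) ij.
      by rewrite !in_itv/= => H /andP[? ?] /andP[? ?]; lra.
    move=> i j; rewrite -val_eqE neq_ltn => /orP[/dis//|/dis].
    by rewrite setIC.
  - rewrite -[X in X < _](big_mkord xpredT
      (fun i => (nth (0, 0) s i).2 - (nth (0, 0) s i).1)).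
    rewrite -(big_nth (0, 0) xpredT (fun p => p.2 - p.1)) -lte_fin.
    apply: (le_lt_trans smu); apply: le_lt_trans muU.
    by apply: le_measure; [rewrite inE; exact: mUI|rewrite inE|exact: subIsetl].
apply: interval_gluing => //.
  move=> u v w au uv vw wb [s [s1 s2 s3 s4]] [s' [s'1 s'2 s'3 s'4]].
  exists (s ++ s'); split.
  - rewrite all_cat; apply/andP; split.
      by apply: sub_all s1 => p /and3P[-> -> /le_trans->].
    by apply: sub_all s'1 => p /and3P[/(le_trans uv)-> -> ->].
  - rewrite pairwise_cat s2 s'2 !andbT; apply/allrelP => p q ps qs.
    move/allP/(_ _ ps)/and3P : s1 => [_ _].
    by move/allP/(_ _ qs)/and3P : s'1 => [? _ _] ?; lra.
  - rewrite big_cat/= EFinD.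
    apply: (le_trans (leeD s3 s'3)); rewrite -[leLHS](measureU (@lebesgue_measure R) (mUI u v) (mUI v w)); last first.
      apply/seteqP; split => // y [] [_ /=] + [_ /=].
      by rewrite !in_itv/= => /andP[? ?] /andP[? ?]; lra.
    apply: le_measure; first (rewrite inE; exact: measurableU (mUI _ _) (mUI _ _)).
      by rewrite inE; exact: mUI.
    move=> y [] [Uy /=]; rewrite !in_itv/= => /andP[y1 y2]; split => //=.
      by rewrite y1 (le_trans y2).
    by rewrite y2 (le_lt_trans uv).
  - by rewrite big_cat/=; lra.
(* Near a point of [Z] the whole interval lies in [U] and is listed as the single pair [(u, v)];
   near any other point the slope bound suffices and the list is empty. *)
move=> s as_ sb; have [Zs|nZs] := pselect (Z s).
  have [r r0 rU] : exists2 r, 0 < r & ball s r `<=` U.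
    have /nbhs_ballP[r r0 rU] : nbhs s U by apply: open_nbhs_nbhs; split=> //; exact: ZU.
    by exists r.
  exists r => // u v au us sv vb ur vr; exists [:: (u, v)]; split => /=.
  - by rewrite !lexx !andbT; lra.
  - by [].
  - rewrite big_seq1/= (_ : U `&` _ = `]u, v]%classic).
      rewrite lebesgue_measure_itv/= lte_fin; case: ltP => // ?.
      by rewrite lee_fin; lra.
    apply/seteqP; split => [y []//|y yuv]; split => //.
    apply: rU; rewrite -ball_normE/=; move: yuv; rewrite /= in_itv/= => /andP[? ?].
    by rewrite ltr_norml; lra.
  - rewrite big_seq1/=.
    have := ler_norm (h v - h u).
    suff : 0 <= (M + e') * (v - u) by lra.
    by rewrite mulr_ge0//; lra.
have [r r0 Hr] : exists2 r, 0 < r & forall u v, a <= u -> u <= s -> s <= v ->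
    v <= b -> s - u < r -> v - s < r -> h v - h u <= (M + e') * (v - u).
  have [H|nH] := pselect (a <= s <= b -> forall e0 : R, 0 < e0 ->
    exists2 r : R, 0 < r & forall u v : R, a <= u -> u <= s -> s <= v ->
    v <= b -> s - u < r -> v - s < r -> h v - h u <= (M + e0) * (v - u)).
    by apply: H => //; rewrite as_ sb.
  by exfalso; apply: nZs; apply: subZ.
exists r => // u v au us sv vb ur vr; exists [::]; split => //=.
  by rewrite big_nil measure_ge0.
by rewrite big_nil addr0; exact: Hr.
Qed.

(** * Arbitrary norms on row vectors *)

Lemma is_norm0 (R : realType) (V : lmodType R) (nrm : V -> R) :
  is_norm nrm -> nrm 0 = 0.
Proof. by move=> [_ nZ _]; rewrite -(scale0r (0 : V)) nZ normr0 mul0r. Qed.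

Lemma is_normN (R : realType) (V : lmodType R) (nrm : V -> R) (v : V) :
  is_norm nrm -> nrm (- v) = nrm v.
Proof. by move=> [_ nZ _]; rewrite -scaleN1r nZ normrN1 mul1r. Qed.

Lemma is_norm_ge0 (R : realType) (V : lmodType R) (nrm : V -> R) (v : V) :
  is_norm nrm -> 0 <= nrm v.
Proof.
move=> nP; have [nD _ _] := nP; have := nD v (- v).
by rewrite subrr (is_norm0 nP) (is_normN v nP) -mulr2n pmulrn_lge0.
Qed.

Lemma is_norm_le_dist (R : realType) (V : lmodType R) (nrm : V -> R) (u v : V) :
  is_norm nrm -> nrm u - nrm v <= nrm (u - v).
Proof. by move=> [nD _ _]; rewrite lerBlDr -{1}(subrK v u). Qed.

Lemma is_norm_ler_distl (R : realType) (V : lmodType R) (nrm : V -> R)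
    (u v : V) :
  is_norm nrm -> `|nrm u - nrm v| <= nrm (u - v).
Proof.
move=> nP; rewrite ler_norml is_norm_le_dist// andbT lerNl opprB.
by rewrite -(is_normN (u - v) nP) opprB is_norm_le_dist.
Qed.

(** Expansion in the standard basis. This transfers to [nrm] the smallness estimates that
    derivatives and absolute continuity give for the maximum norm. *)
Lemma is_norm_le_mx_norm (R : realType) (d : nat) (nrm : 'rV[R]_d -> R) :
  is_norm nrm -> exists2 C, 0 < C & forall v, nrm v <= C * `|v|.
Proof.
move=> nP; have [nD nZ _] := nP.
pose C := \sum_(i < d) nrm (delta_mx 0 i).
have C0 : 0 <= C by apply: sumr_ge0 => i _; exact: is_norm_ge0.
(* The added 1 keeps the constant positive when [d = 0], where the sum is empty. *)
exists (C + 1) => [|v]; first by rewrite ltr_wpDl.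
apply: (@le_trans _ _ (C * `|v|)); last first.
  by rewrite ler_wpM2r// lerDl.
rewrite {1}(row_sum_delta v).
have nsum (F : 'I_d -> 'rV[R]_d) : nrm (\sum_i F i) <= \sum_i nrm (F i).
  elim/big_ind2 : _ => //; first by rewrite is_norm0.
  by move=> a1 b1 a2 b2 h1 h2; apply: (le_trans (nD _ _)); exact: lerD.
apply: (le_trans (nsum _)); rewrite /C mulr_suml; apply: ler_sum => i _.
rewrite nZ mulrC ler_wpM2l ?is_norm_ge0//.
rewrite [leRHS]/Num.norm/= mx_normrE.
by apply: (le_trans _ (le_bigmax _ _ (0, i))).
Qed.

(** * Derivatives and absolute continuity of curves *)

(** The straddle lemma: the errors on the two sides of [s] are at most [e * (s - u)] and
    [e * (v - s)], and these add up exactly because [s] lies between [u] and [v]. *)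
Lemma is_derive_straddle (R : realType) (V : normedModType R) (x : R -> V)
    (s : R) (df : V) (e : R) :
  is_derive s 1 x df -> 0 < e ->
  exists2 r, 0 < r & forall u v, u <= s -> s <= v -> s - u < r -> v - s < r ->
    `|x v - x u - (v - u) *: df| <= e * (v - u).
Proof.
move=> [dx dxE] e0.
have : (fun h => h^-1 *: ((x \o shift s) (h *: 1) - x s)) @ 0^' --> df.
  by rewrite -dxE; exact: dx.
move/cvgrPdist_le/(_ _ e0).
move=> /nbhs_ballP[r r0 Hr]; exists r => //.
have key h : `|h| < r -> `|x (s + h) - x s - h *: df| <= e * `|h|.
  move=> hr; have [->|h0] := eqVneq h 0.
    by rewrite addr0 subrr scale0r subrr normr0 normr0 mulr0.
  have := Hr h; rewrite -ball_normE/= sub0r normrN => /(_ hr h0).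
  rewrite distrC /shift/= [h *: 1]mulr1 (addrC h s) => H.
  have -> : x (s + h) - x s - h *: df = h *: (h^-1 *: (x (s + h) - x s) - df).
    by rewrite scalerBr scalerA divff// scale1r.
  by rewrite normrZ mulrC ler_wpM2r.
move=> u v us sv ur vr.
have /key : `|v - s| < r by rewrite ger0_norm ?subr_ge0.
have /key : `|u - s| < r by rewrite distrC ger0_norm ?subr_ge0.
rewrite !subrKC (distrC u s) !ger0_norm ?subr_ge0// => Hu Hv.
have -> : x v - x u - (v - u) *: df =
    (x v - x s - (v - s) *: df) - (x u - x s - (u - s) *: df).
  have <- : x v - x s - (x u - x s) = x v - x u by rewrite opprB addrA subrK.
  have <- : (v - s) *: df - (u - s) *: df = (v - u) *: df.
    by rewrite -scalerBl opprB addrA subrK.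
  by rewrite (opprD ((v - s) *: df)) addrACA -opprD.
by apply: (le_trans (ler_normB _ _)); apply: (le_trans (lerD Hv Hu)); lra.
Qed.

Lemma abs_continuous_bounded (R : realType) (V : normedModType R) (a b : R)
    (x : R -> V) :
  abs_continuous_on a b x ->
  exists2 K, 0 <= K & forall s, a <= s <= b -> `|x s| <= K.
Proof.
move=> /(_ 1 ltr01)[d d0 acd].
have acd1 u v : a <= u -> u <= v -> v <= b -> v - u < d -> `|x v - x u| < 1.
  move=> au uv vb vud; have := acd 1 (fun=> u) (fun=> v).
  rewrite !big_ord1; apply => // i j; first by rewrite !ord1.
(* With this many equal steps from [a] to [s], each step is shorter than [d], hence changes [x] by
   less than 1; [n] does not depend on [s]. *)
pose n := (Num.truncn ((b - a) / d)).+1.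
have n0 : 0 < n%:R :> R by rewrite ltr0n.
exists (`|x a| + n%:R); first by rewrite addr_ge0.
move=> s /andP[as_ sb]; pose c := (s - a) / n%:R.
have c0 : 0 <= c by rewrite divr_ge0// subr_ge0.
have cd : c < d.
  rewrite ltr_pdivrMr// mulrC -ltr_pdivrMr//.
  apply: le_lt_trans (truncnS_gt _).
  by rewrite ler_pM2r ?invr_gt0// lerB.
have sE : s = a + n%:R * c by rewrite /c mulrC divfK ?gt_eqF// subrKC.
have -> : x s = x a + \sum_(0 <= k < n) (x (a + k.+1%:R * c) - x (a + k%:R * c)).
  by rewrite (telescope_sumr (fun k => x (a + k%:R * c)))// mul0r addr0 -sE subrKC.
apply: (le_trans (ler_normD _ _)); rewrite lerD2l.
apply: (le_trans (ler_norm_sum _ _ _)).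
rewrite [leRHS](_ : _ = \sum_(0 <= k < n) 1); last first.
  by rewrite big_const_nat iter_addr subn0 addr0.
rewrite !big_nat; apply: ler_sum => k /andP[_ kn]; apply/ltW/acd1.
- by rewrite lerDl mulr_ge0.
- by rewrite lerD2l ler_wpM2r// ler_nat.
- rewrite (le_trans _ sb)// sE lerD2l ler_wpM2r// ler_nat//.
- by rewrite (_ : _ - _ = c)// -natr1; ring.
Qed.

Lemma abs_continuousB (R : realType) (V : normedModType R) (a b : R)
    (x y : R -> V) :
  abs_continuous_on a b x -> abs_continuous_on a b y ->
  abs_continuous_on a b (x \- y).
Proof.
move=> acx acy e e0; have e20 : 0 < e / 2 by lra.
have [dx dx0 Hx] := acx _ e20; have [dy dy0 Hy] := acy _ e20.
exists (Num.min dx dy) => [|m l r lr dis]; first by rewrite lt_min dx0.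
rewrite lt_min => /andP[/(Hx _ _ _ lr dis) hx /(Hy _ _ _ lr dis) hy].
apply: (@le_lt_trans _ _ (\sum_i `|x (r i) - x (l i)| +
    \sum_i `|y (r i) - y (l i)|)); last lra.
rewrite -big_split/=; apply: ler_sum => i _.
by rewrite /= opprD addrACA -opprD ler_normB.
Qed.

Lemma abs_continuous_sub (R : realType) (V : normedModType R) (a b a' b' : R)
    (x : R -> V) :
  a <= a' -> b' <= b -> abs_continuous_on a b x -> abs_continuous_on a' b' x.
Proof.
move=> aa' b'b acx e e0; have [d d0 Hd] := acx e e0.
exists d => // m l r lr; apply: Hd => i.
by have [h1 h2 h3] := lr i; split; [exact: le_trans h1| |exact: le_trans b'b].
Qed.

Lemma abs_continuous_shift (R : realType) (V : normedModType R) (a b c : R)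
    (x : R -> V) :
  abs_continuous_on (a + c) (b + c) x ->
  abs_continuous_on a b (fun s => x (s + c)).
Proof.
move=> acx e e0; have [d d0 Hd] := acx e e0.
exists d => // m l r lr dis lrd.
apply: (Hd m (fun i => l i + c) (fun i => r i + c)).
- by move=> i; have [] := lr i; rewrite !lerD2r.
- move=> i j /dis/seteqP[/= ij _]; apply/seteqP; split => // s.
  rewrite /= !in_itv/= => -[/andP[i1 i2] /andP[j1 j2]].
  apply: (ij (s - c)); split.
    by rewrite /= in_itv/= ltrBrDr ltrBlDr i1.
  by rewrite /= in_itv/= ltrBrDr ltrBlDr j1.
- by under eq_bigr do rewrite opprD addrACA subrr addr0.
Qed.

(** * Gronwall inequality and comparison of solutions *)

Lemma expRN_lipschitz (R : realType) (L u v : R) :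
  0 <= L -> 0 <= u -> u <= v ->
  `|expR (- (L * v)) - expR (- (L * u))| <= L * (v - u).
Proof.
move=> L0 u0 uv.
have e1 : expR (- (L * u)) <= 1 by rewrite -expR0 ler_expR oppr_le0 mulr_ge0.
have D0 : 0 <= L * (v - u) by rewrite mulr_ge0 ?subr_ge0.
have -> : expR (- (L * v)) = expR (- (L * u)) * expR (- (L * (v - u))).
  by rewrite -expRD; congr expR; ring.
rewrite -{2}[expR (- (L * u))]mulr1 -mulrBr normrM (ger0_norm (expR_ge0 _)).
have := expR_ge1Dx (- (L * (v - u))).
have e2 : expR (- (L * (v - u))) <= 1 by rewrite -expR0 ler_expR oppr_le0.
rewrite distrC ger0_norm ?subr_ge0// => H.
apply: (@le_trans _ _ (1 * (1 - expR (- (L * (v - u)))))); last lra.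
by rewrite ler_wpM2r// subr_ge0.
Qed.

(* The weight exp (- L s) turns the differential inequality g' <= L g + M into
   h' <= M for h s = exp (- L s) * g s. *)
Lemma gronwall_abs_continuous (R : realType) (g : R -> R) (L M c : R) :
  0 <= L -> 0 <= M -> 0 <= c ->
  abs_continuous_on 0 c (g : R -> R^o) -> (forall s, 0 <= g s) -> g 0 = 0 ->
  (\forall s \ae (@lebesgue_measure R), 0 <= s <= c ->
    forall e, 0 < e -> exists2 r, 0 < r &
    forall u v, 0 <= u -> u <= s -> s <= v -> v <= c ->
      s - u < r -> v - s < r ->
      g v - g u <= (L * g s + M + e) * (v - u) /\ g s - g u <= e) ->
  g c <= M * c * expR (L * c).
Proof.
move=> L0 M0 c0 acg g_ge0 g0 Hg.
pose h s := expR (- (L * s)) * g s.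
suff : h c - h 0 <= M * (c - 0).
  rewrite /h g0 mulr0 !subr0 expRN mulrC ler_pdivrMr ?expR_gt0//.
apply: abs_continuous_growth => //.
  (* Absolute continuity of the product [h]: the weight is at most 1 and [L]-Lipschitz, and [g] is
     bounded by [K], so the variation of [h] exceeds that of [g] by at most [L * K] times the total
     length. *)
  have [K K0 HK] := abs_continuous_bounded acg.
  move=> e e0.
  have [d d0 Hd] := acg (e / 2) ltac:(lra).
  have LK0 : 0 <= L * K by rewrite mulr_ge0.
  pose d' := e / 2 / (L * K + 1).
  have d'0 : 0 < d' by rewrite !divr_gt0//; lra.
  exists (Num.min d d') => [|m l r lr dis]; first by rewrite lt_min d0.
  rewrite lt_min => /andP[/(Hd _ _ _ lr dis) hd lrd'].
  apply: (@le_lt_trans _ _ (\sum_i `|g (r i) - g (l i)| +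
      \sum_i (L * K) * (r i - l i))).
    rewrite -big_split/=; apply: ler_sum => i _.
    have [l0 lir rc] := lr i.
    have -> : h (r i) - h (l i) = expR (- (L * r i)) * (g (r i) - g (l i)) +
        (expR (- (L * r i)) - expR (- (L * l i))) * g (l i).
      by rewrite /h; ring.
    apply: (le_trans (ler_normD _ _)); apply: lerD.
      rewrite normrM ler_piMl// ger0_norm ?expR_ge0// -expR0 ler_expR.
      by rewrite oppr_le0 mulr_ge0// (le_trans l0).
    rewrite normrM mulrAC; apply: ler_pM => //; first exact: expRN_lipschitz.
    by apply: HK; rewrite l0 (le_trans lir).
  rewrite -mulr_sumr.
  suff : L * K * (\sum_i (r i - l i)) <= e / 2 by lra.
  apply: (@le_trans _ _ (L * K * d')); first by rewrite ler_wpM2l// ltW.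
  rewrite /d' mulrCA ler_piMr//; first lra.
  by rewrite ler_pdivrMr; lra.
move: Hg; apply: (@filterS _ _ (ae_filter_ringOfSetsType (@lebesgue_measure R))).
move=> s Hg s0c e e0.
(* The tolerance enters twice, once directly and once multiplied by [L] through [g s - g u], so the
   total error is [(1 + L) * e' = e]. *)
pose e' := e / (1 + L).
have e'0 : 0 < e' by rewrite divr_gt0//; lra.
have [r r0 Hr] := Hg s0c e' e'0.
exists r => // u v u0 us sv vc ur vr.
have [gvu gsu] := Hr u v u0 us sv vc ur vr.
have uv : 0 <= v - u by lra.
have -> : h v - h u = expR (- (L * v)) * (g v - g u) -
    g u * (expR (- (L * v)) * (expR (L * (v - u)) - 1)).
  have -> : expR (- (L * v)) * (expR (L * (v - u)) - 1) =
      expR (- (L * u)) - expR (- (L * v)).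
    by rewrite mulrBr mulr1 -expRD; congr (expR _ - _); ring.
  by rewrite /h; ring.
have E0 := expR_gt0 (- (L * v)).
have E1 : expR (- (L * v)) <= 1.
  by rewrite -expR0 ler_expR oppr_le0 mulr_ge0//; lra.
have E2 := expR_ge1Dx (L * (v - u)).
(* The decrease of the weight is bounded below by [1 + y <= expR y]; the sign is right because [g u]
   is nonnegative. *)
apply: (@le_trans _ _ (expR (- (L * v)) * (g v - g u) -
    g u * (expR (- (L * v)) * (L * (v - u))))).
  rewrite lerD2l lerN2 ler_wpM2l// ler_wpM2l//; lra.
apply: (@le_trans _ _ (expR (- (L * v)) *
    ((L * g s + M + e') * (v - u) - g u * (L * (v - u))))).
  by rewrite [leRHS]mulrBr lerB ?ler_wpM2l ?(ltW E0)// mulrCA.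
have eE : e = e' + L * e'.
  by rewrite /e' -[X in X + _]mul1r -mulrDl mulrC divfK//; lra.
(* The growth term [L * g s] is taken at [s] but the weight contributes [- L * g u]; the second half
   of the hypothesis controls the mismatch. *)
apply: (@le_trans _ _ (expR (- (L * v)) * ((M + e) * (v - u)))).
  rewrite ler_wpM2l ?(ltW E0)// [leLHS](_ : _ =
    (L * (g s - g u) + M + e') * (v - u)); last by ring.
  rewrite ler_wpM2r// eE.
  by have := ler_wpM2l L0 gsu; lra.
by rewrite ler_piMl// mulr_ge0//; lra.
Qed.

(** For almost every [s] the derivative of [x1 - x2] has norm at most [L1 * g s + L2 * eta]. The
    reverse triangle inequality passes this from increments of the difference to increments of its
    norm [g], as Gronwall requires. *)
Lemma ode_comparison (R : realType) (d : nat) (nrm : 'rV[R]_d -> R)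
    (f : 'rV[R]_d -> R -> 'rV[R]_d) (u1 u2 : R -> R) (x0 : 'rV[R]_d)
    (T L1 L2 eta : R) (x1 x2 : R -> 'rV[R]_d) :
  is_norm nrm ->
  (forall c : R, lipschitz_with nrm nrm L1 (fun z => f z c)) ->
  (forall z, lipschitz_with (fun c : R => `|c|) nrm L2 (f z)) ->
  0 <= eta ->
  (\forall s \ae (@lebesgue_measure R), 0 <= s <= T -> `|u1 s - u2 s| <= eta) ->
  ode_solution f u1 x0 T x1 -> ode_solution f u2 x0 T x2 ->
  forall s, 0 <= s <= T -> nrm (x1 s - x2 s) <= L2 * eta * s * expR (L1 * s).
Proof.
move=> nP lip1 lip2 eta0 Hu [x10 acx1 dx1] [x20 acx2 dx2] c /andP[c0 cT].
have L10 : 0 <= L1 by have [] := lip1 0.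
have L20 : 0 <= L2 by have [] := lip2 0.
have [nD nZ _] := nP.
have [C C0 HC] := is_norm_le_mx_norm nP.
pose w := x1 \- x2.
pose g s := nrm (w s).
have g0 s : 0 <= g s by exact: is_norm_ge0 (w s) nP.
apply: (gronwall_abs_continuous (g := g)) => //.
- by rewrite mulr_ge0.
- have acw : abs_continuous_on 0 c w.
    by apply: abs_continuousB; exact: abs_continuous_sub (lexx 0) cT _.
  move=> e e0; have [d' d'0 Hd] := acw (e / C) (divr_gt0 e0 C0).
  exists d' => // m l r lr dis /(Hd _ _ _ lr dis).
  rewrite ltr_pdivlMr// mulrC mulr_sumr; apply: le_lt_trans.
  apply: ler_sum => i _; apply: le_trans (HC _).
  exact: is_norm_ler_distl (w (r i)) (w (l i)) nP.
- by rewrite /g /w/= x10 x20 subrr is_norm0.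
have FF := ae_filter_ringOfSetsType (@lebesgue_measure R).
apply: (@filterS3 _ _ FF _ _ _ _ _ Hu dx1 dx2).
move=> s Hus Hd1 Hd2 /andP[s0 sc] e e0.
have s0T : 0 <= s <= T by rewrite s0 (le_trans sc).
pose df := f (x1 s) (u1 s) - f (x2 s) (u2 s).
have dw : is_derive s 1 w df.
  by apply: is_deriveB; [exact: Hd1|exact: Hd2].
have dfle : nrm df <= L1 * g s + L2 * eta.
  rewrite /df -(subrKA (f (x2 s) (u1 s))).
  apply: (le_trans (nD _ _)); apply: lerD.
    by have [_] := lip1 (u1 s); apply.
  have [_ H] := lip2 (x2 s); apply: (le_trans (H _ _)).
  by rewrite ler_wpM2l// Hus.
have eC0 : 0 < e / C by rewrite divr_gt0.
have [r r0 Hr] := is_derive_straddle dw eC0.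
have key u v : u <= s -> s <= v -> s - u < r -> v - s < r ->
    g v - g u <= (L1 * g s + L2 * eta + e) * (v - u).
  move=> us sv ur vr; have uv : 0 <= v - u by lra.
  apply: (le_trans (is_norm_le_dist _ _ nP)).
  rewrite -[w v - w u](subrK ((v - u) *: df)).
  apply: (le_trans (nD _ _)); rewrite nZ ger0_norm// [leLHS]addrC [leRHS]mulrDl.
  apply: lerD; first by rewrite mulrC ler_wpM2r.
  apply: (le_trans (HC _)).
  apply: (@le_trans _ _ (C * (e / C * (v - u)))).
    by rewrite ler_pM2l//; exact: Hr.
  by rewrite mulrA [C * _]mulrC divfK// gt_eqF.
(* [B] is the slope bound of [key], so the radius [e / B] forces [g s - g u <= e]. *)
pose B := L1 * g s + L2 * eta + e.
have B0 : 0 < B by rewrite ltr_wpDl// addr_ge0 ?mulr_ge0.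
exists (Num.min r (e / B)) => [|u v _ us sv _].
  by rewrite lt_min r0 divr_gt0.
rewrite !lt_min => /andP[ur uB] /andP[vr vB]; split; first exact: key.
have := key u s us (lexx s) ur; rewrite subrr => /(_ r0) /le_trans; apply.
by rewrite -/B mulrC -ler_pdivlMr// ltW.
Qed.

(** * Translation, essential bounds and the piecewise input *)

(** The image of Lebesgue measure under a translation agrees with it on half-open intervals, hence
    everywhere, so translates of null sets are null. *)
Lemma ae_lebesgue_shift (R : realType) (P : R -> Prop) (c : R) :
  (\forall s \ae (@lebesgue_measure R), P s) ->
  \forall s \ae (@lebesgue_measure R), P (s + c).
Proof.
move=> [A [mA A0 PA]].
pose sh : measurableTypeR R -> measurableTypeR R := fun s => s + c.
have msh : measurable_fun setT sh.
  by apply: measurable_funD; [exact: measurable_id|exact: measurable_cst].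
exists (sh @^-1` A); split.
- by rewrite -[_ @^-1` _]setTI; exact: msh.
- rewrite -A0 -[LHS]/(pushforward (@lebesgue_measure R) sh A).
  apply/esym/lebesgue_measure_unique => //.
  move=> _ [[a b] _ <-]; rewrite /pushforward.
  rewrite [X in _ = lebesgue_measure X](_ : _ = `]a - c, b - c]%classic); last first.
    by apply/seteqP; split => s; rewrite /sh/= !in_itv/= ltrBlDr lerBrDr.
  rewrite !lebesgue_measure_itv/= !lte_fin ltrD2r.
  by case: ifP => // _; rewrite -!EFinD opprD addrACA subrr addr0.
- by move=> s /= nP; apply: PA.
Qed.

Lemma Linfty_norm_itv_le (R : realType) (a b eta : R) (g : R -> R) :
  a < b -> (Linfty_norm_itv a b g <= eta%:E)%E ->
  0 <= eta /\
  \forall s \ae (@lebesgue_measure R), a <= s <= b -> `|g s| <= eta.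
Proof.
move=> ab; rewrite /Linfty_norm_itv => gle; split.
  by rewrite -lee_fin; apply: le_trans gle; exact: Lnorm_ge0.
move: gle; rewrite unlock.
set mu := mrestr _ _.
(* The norm with exponent infinity is an essential supremum only when the total mass is positive,
   which [a < b] ensures. *)
have -> : (0 < mu setT)%E.
  rewrite /mu /mrestr setTI lebesgue_measure_itv/= lte_fin ab.
  by rewrite -EFinD lte_fin subr_gt0.
move=> /ess_supP[A [mA A0 PA]].
exists (A `&` `[a, b]%classic); split.
- by apply: measurableI => //; exact: measurable_itv.
- by move: A0; rewrite /mu /mrestr.
- move=> s /= nP; split.
    by apply: PA => /= H; apply: nP => _; rewrite -lee_fin.
  by rewrite /= in_itv/=; apply: contrapT => nab; apply: nP => sab.
Qed.

Lemma nodes_le (R : realType) (N : nat) (t : nat -> R) :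
  (forall k, (k < N)%N -> t k < t k.+1) ->
  forall k m, (k <= m)%N -> (m <= N)%N -> t k <= t m.
Proof.
move=> t_incr k; elim=> [|m IH]; first by rewrite leqn0 => /eqP->.
rewrite leq_eqVlt => /predU1P[->//|km] mN.
by rewrite (le_trans (IH km (ltnW mN)))// ltW// t_incr.
Qed.

(** Strict inequalities on [tau] keep the point away from the nodes, where two closed indicators
    overlap; elsewhere only the [n]-th term survives. *)
Lemma piecewise_input_interior (R : realType) (nb : nat) (b : 'I_nb -> R -> R)
    (N : nat) (t : nat -> R) (G : nat -> 'rV[R]_nb) (n : nat) (tau : R) :
  (forall k, (k < N)%N -> t k < t k.+1) -> (n < N)%N ->
  0 < tau -> tau < t n.+1 - t n ->
  piecewise_input b N t G (tau + t n) = local_input b (G n) tau.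
Proof.
move=> t_incr nN tau0 taud.
have tle := nodes_le t_incr.
rewrite /piecewise_input (bigD1 (Ordinal nN))//= addrK.
rewrite indicE mem_set ?mulr1; last first.
  by rewrite /= in_itv/=; apply/andP; split; lra.
rewrite big1 ?addr0// => k; rewrite -val_eqE/= neq_ltn => kn.
rewrite indicE memNset ?mulr0//= in_itv/= => /andP[h1 h2].
case/orP: kn => [kn|nk].
  by have := tle _ _ kn (ltnW nN); lra.
by have := tle _ _ nk (ltnW (ltn_ord k)); lra.
Qed.

(** * The one-step increment along the modified solution *)

(** Existence of [y] makes [xget] return a solution, and comparison under a common input, with
    tolerance 0, identifies its endpoint with that of [y]. *)
Lemma one_step_increment_sol (R : realType) (d nb : nat)
    (nrm : 'rV[R]_d -> R) (f : 'rV[R]_d -> R -> 'rV[R]_d)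
    (b : 'I_nb -> R -> R) (z : 'rV[R]_d) (G : 'rV[R]_nb) (delta L1 L2 : R)
    (y : R -> 'rV[R]_d) :
  is_norm nrm ->
  (forall c : R, lipschitz_with nrm nrm L1 (fun z => f z c)) ->
  (forall z, lipschitz_with (fun c : R => `|c|) nrm L2 (f z)) ->
  0 <= delta -> ode_solution f (local_input b G) z delta y ->
  one_step_increment f b z G delta = y delta - z.
Proof.
move=> nP lip1 lip2 d0 yP; rewrite /one_step_increment; congr (_ - _).
set S := [set _ | _].
have y'P : S (xget (cst z) S) by apply: xgetPex; exists y.
have [_ _ neq0] := nP; apply/eqP; rewrite -subr_eq0; apply/eqP/neq0.
apply/eqP; rewrite eq_le (is_norm_ge0 _ nP) andbT.
rewrite (le_trans (ode_comparison nP lip1 lip2 (lexx 0) _ y'P yP _))//.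
- by apply: aeW => s _; rewrite subrr normr0.
- by rewrite d0 lexx.
- by rewrite mulr0 !mul0r.
Qed.

(** The two inputs may differ at the endpoints of the step, which form a null set and are discarded
    in the almost everywhere equation. *)
Lemma ode_solution_piecewise_step (R : realType) (d nb : nat)
    (f : 'rV[R]_d -> R -> 'rV[R]_d) (b : 'I_nb -> R -> R) (N : nat)
    (t : nat -> R) (G : nat -> 'rV[R]_nb) (x0 : 'rV[R]_d)
    (x : R -> 'rV[R]_d) (n : nat) :
  (forall k, (k < N)%N -> t k < t k.+1) -> (n < N)%N ->
  0 <= t n -> t n.+1 <= t N ->
  ode_solution f (piecewise_input b N t G) x0 (t N) x ->
  ode_solution f (local_input b (G n)) (x (t n)) (t n.+1 - t n)
    (fun s => x (s + t n)).
Proof.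
move=> t_incr nN tn0 tnN [_ acx dx]; have tn := t_incr n nN.
split; first by rewrite add0r.
  apply: abs_continuous_shift; apply: abs_continuous_sub acx; lra.
have FF := ae_filter_ringOfSetsType (@lebesgue_measure R).
have ne (c : R) : \forall s \ae (@lebesgue_measure R), s != c.
  exists [set c]; split; [exact: measurable_set1|exact: lebesgue_measure_set1|].
  by move=> s /= /negP; rewrite negbK => /eqP.
have dx' := ae_lebesgue_shift (t n) dx.
move: (ne 0) (ne (t n.+1 - t n)) dx'; apply: filterS3 => s s0 s1 dxs /andP[s0' s1'].
rewrite -(piecewise_input_interior b G t_incr nN); last 2 first.
- by rewrite lt_neqAle eq_sym s0.
- by rewrite lt_neqAle s1.
have : 0 <= s + t n <= t N by apply/andP; split; lra.
move=> /dxs [ddx <-].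
have E : (fun h : R => h^-1 *: (((fun s => x (s + t n)) \o shift s) (h *: 1) -
    x (s + t n))) = (fun h => h^-1 *: ((x \o shift (s + t n)) (h *: 1) - x (s + t n))).
  by apply/funext => h; rewrite /= addrA.
by split; rewrite /derivable /derive E.
Qed.

(** * Accumulation of the network error *)

(** [xhat_in_domain] places the inputs met by the network where [train_acc] controls it. [Lphi_neq1]
    makes the quotient a geometric sum; division by 0 yields 0, so for [Lphi = 1] the last term
    would vanish. *)
Theorem theorem3p5 (R : realType) (d nb : nat)
  (nrm : 'rV[R]_d -> R) (nrmP : is_norm nrm)
  (f : 'rV[R]_d -> R -> 'rV[R]_d) (gamma : R -> R)
  (b : 'I_nb -> R -> R)
  (b_analytic : forall j tau, 0 <= tau -> real_analytic_at (b j) tau)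
  (N : nat) (T : R) (t : nat -> R)
  (T_gt0 : 0 < T) (t0 : t 0%N = 0) (tN : t N = T)
  (t_incr : forall n, (n < N)%N -> t n < t n.+1)
  (x0 : 'rV[R]_d) (Gamma : nat -> 'rV[R]_nb)
  (x xtilde : R -> 'rV[R]_d)
  (x_sol : ode_solution f gamma x0 T x)
  (xtilde_sol : ode_solution f (piecewise_input b N t Gamma) x0 T xtilde)
  (J : nat) (data : 'I_J -> training_datum R d nb)
  (sigma : nat -> R -> R) (Theta : ffn_params R (d + nb + 1) d)
  (xhat : nat -> 'rV[R]_d)
  (xhat0 : xhat 0%N = x0)
  (xhatS : forall n, (n < N)%N ->
    xhat n.+1 = xhat n +
      ffn_eval sigma Theta (pack_input (xhat n) (Gamma n) (t n.+1 - t n)))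
  (L1 L2 Lphi eta E : R)
  (f_lip1 : forall c : R, lipschitz_with nrm nrm L1 (fun z => f z c))
  (f_lip2 : forall z : 'rV[R]_d,
    lipschitz_with (fun c : R => `|c|) nrm L2 (f z))
  (gamma_approx :
    (Linfty_norm_itv 0 T
       (fun s => (gamma s - piecewise_input b N t Gamma s)%R) <= eta%:E)%E)
  (evol_lip : forall n, (n < N)%N ->
    lipschitz_with nrm nrm Lphi
      (fun z => z + one_step_increment f b z (Gamma n) (t n.+1 - t n)))
  (Lphi_neq1 : Lphi != 1)
  (E_ge0 : 0 <= E)
  (train_acc :
    (Linfty_norm_on nrm (training_domain data)
       (fun p => (ffn_eval sigma Theta p - increment_operator f b p)%R)
     < E%:E)%E)
  (xhat_in_domain : forall n, (n < N)%N ->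
    training_domain data (pack_input (xhat n) (Gamma n) (t n.+1 - t n))) :
  forall n : nat, (n <= N)%N ->
    nrm (xhat n - x (t n)) <=
      L2 * eta * t n * expR (L1 * t n) + (1 - Lphi ^+ n) / (1 - Lphi) * E.
Proof.
have [nD nZ _] := nrmP.
have tle := nodes_le t_incr.
have [eta0 Hgamma] := Linfty_norm_itv_le T_gt0 gamma_approx.
have xtildeS n : (n < N)%N -> xtilde (t n.+1) =
    xtilde (t n) + one_step_increment f b (xtilde (t n)) (Gamma n) (t n.+1 - t n).
  move=> nN; have tn0 : 0 <= t n by rewrite -t0 tle// ltnW.
  have tnN : t n.+1 <= t N by exact: tle.
  rewrite -tN in xtilde_sol.
  have yP := ode_solution_piecewise_step t_incr nN tn0 tnN xtilde_sol.
  have d0 : 0 <= t n.+1 - t n by rewrite subr_ge0 ltW// t_incr.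
  by rewrite (one_step_increment_sol nrmP f_lip1 f_lip2 d0 yP) subrK subrKC.
have network_error n : (n <= N)%N ->
    nrm (xhat n - xtilde (t n)) <= (1 - Lphi ^+ n) / (1 - Lphi) * E.
  elim: n => [_|n IH nN].
    have [xt0 _ _] := xtilde_sol.
    by rewrite expr0 subrr !mul0r t0 xt0 xhat0 subrr is_norm0.
  have [Lphi0 lipn] := evol_lip n nN.
  rewrite xhatS// xtildeS//.
  set p := pack_input _ _ _.
  set ph := fun z => one_step_increment f b z (Gamma n) (t n.+1 - t n).
  have incE : increment_operator f b p = ph (xhat n).
    by rewrite /increment_operator /p /pack_input !row_mxKl !row_mxKr mxE.
  have netE : nrm (ffn_eval sigma Theta p - ph (xhat n)) <= E.
    rewrite -lee_fin -incE; apply: le_trans (ltW train_acc).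
    by apply: ereal_sup_ubound => /=; exists p => //; exact: xhat_in_domain.
  (* The first summand is the network defect at [xhat n]; the second is the previous error
     transported by the exact evolution, to which [Lphi] applies. *)
  rewrite (_ : _ - _ = (ffn_eval sigma Theta p - ph (xhat n)) +
      ((xhat n + ph (xhat n)) - (xtilde (t n) + ph (xtilde (t n))))); last first.
    by rewrite [RHS]addrA; congr (_ - _); rewrite addrACA addNr addr0 addrC.
  apply: (le_trans (nD _ _)); apply: (le_trans (lerD netE (lipn _ _))).
  apply: (le_trans (lerD (lexx E) (ler_wpM2l Lphi0 (IH (ltnW nN))))).
  rewrite le_eqVlt; apply/orP; left; apply/eqP.
  have L1' : 1 - Lphi != 0 by rewrite subr_eq0 eq_sym.
  by rewrite exprS; field.
move=> n nN.
have tn : 0 <= t n <= T by rewrite -{1}t0 -tN !tle.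
rewrite -(subrKA (xtilde (t n))) addrC; apply: (le_trans (nD _ _)); apply: lerD.
  rewrite -(is_normN _ nrmP) opprB.
  exact: (ode_comparison nrmP f_lip1 f_lip2 eta0 Hgamma x_sol xtilde_sol).
exact: network_error.
Qed.
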